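(* Let $(\Omega,\Sigma,\mu)$ be a probability space, $N\ge 1$, and $P=\mu^{N}$ the product probability on $\Omega^N$. For every subset $A$ of $\Omega^N$, $$\int_{\Omega^N} \exp\Big(\tfrac14 f_c(A,x)^2\Big)\,dP(x)\le \frac{1}{P(A)} .$$ In particular, for $t\ge 0$, setting $A^c_t=\{x\in\Omega^N : f_c(A,x)\le t\}$, $$P(A^c_t)\ge 1-\frac{1}{P(A)}e^{-t^2/4}.$$
   Context: For $A\subset\Omega^N$ and $x=(x_i)_{i\le N}\in\Omega^N$ let $$U_A(x)=\{(s_i)_{i\le N}\in\{0,1\}^N : \exists y\in A \text{ such that for all } i\le N,\ s_i=0\Rightarrow x_i=y_i\},$$ let $V_A(x)$ be the convex hull of $U_A(x)$ in $\mathbb R^N$, and let $f_c(A,x)$ be the Euclidean ($\ell^2$) distance from $0$ to $V_A(x)$. (The superscript $c$ in $A^c_t$ stands for ''convexity'', not complement.) Measurability convention: sets $A$ are measurable, and all sets and functions are treated as if they were measurable (if measurability fails, the integral is an upper integral and exceptional probabilities are outer probabilities). $1/P(A)=+\infty$ when $P(A)=0$, and the distance to the empty set is $+\infty$. *)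

(* Defs.v *)
From HB Require Import structures.
From mathcomp Require Import all_boot all_order all_algebra.
From mathcomp Require Import all_classical all_reals all_analysis.
From mathcomp Require Import measurable_realfun.
Set Implicit Arguments.
Unset Strict Implicit.
Unset Printing Implicit Defensive.
Import Order.TTheory GRing.Theory Num.Theory.
Import numFieldNormedType.Exports.
Local Open Scope classical_set_scope.
Local Open Scope ring_scope.

Section product_probability.
Context (d : measure_display) (T : measurableType d) (R : realType).

Definition cons_pair (n : nat) (p : T * n.-tuple T) : n.+1.-tuple T :=
  [the n.+1.-tuple T of p.1 :: p.2].

Lemma measurable_cons_pair (n : nat) :
  measurable_fun [set: T * n.-tuple T] (@cons_pair n).
Proof.
by apply: measurable_cons; [exact: measurable_fst|exact: measurable_snd].
Qed.

HB.instance Definition _ (n : nat) :=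
  @isMeasurableFun.Build _ _ _ _ (@cons_pair n) (@measurable_cons_pair n).

(* [iter_prob mu n] is the product probability mu^n on n.-tuple T, built as
   mu^0 = the point mass at the empty tuple and
   mu^(n+1) = the image of mu \x mu^n under (a, x) |-> a :: x.
   [iter_prob_box] is its characteristic property on measurable boxes. *)
Fixpoint iter_prob (mu : probability T R) (n : nat) :
    probability (n.-tuple T) R :=
  match n with
  | 0%N => @dirac _ (0.-tuple T) [tuple] R
  | m.+1 => distribution (mu \x iter_prob mu m)%E
              (@cons_pair m : {mfun _ >-> _})
  end.

Lemma iter_prob_box (mu : probability T R) (n : nat) (B : 'I_n -> set T) :
  (forall i, measurable (B i)) ->
  iter_prob mu n [set x | forall i, B i (tnth x i)] =
  (\prod_(i < n) mu (B i))%E.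
Proof.
elim: n B => [|n IH] B mB.
  rewrite big_ord0 /= diracE mem_set//.
  by case.
rewrite big_ord_recl /= /distribution /pushforward /=.
rewrite (_ : _ @^-1` _ = B ord0 `*`
    [set x | forall i, B (lift ord0 i) (tnth x i)]); last first.
  apply/seteqP; split=> [[a x] /= h|[a x] /= [h0 h] i].
    split; first by have := h ord0.
    by move=> i; have := h (lift ord0 i); rewrite tnthS.
  by case: (unliftP ord0 i) => [j ->|->//]; rewrite tnthS.
rewrite product_measure1E//; last first.
  rewrite (_ : [set x | _] = \bigcap_(i in [set: 'I_n])
      ((@tnth n T ^~ i) @^-1` B (lift ord0 i))); last first.
    by apply/seteqP; split=> x /= h i; [move=> _|]; exact: h.
  apply: fin_bigcap_measurable => // i _.
  by rewrite -[X in measurable X]setTI; exact: measurable_tnth.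
by congr (_ * _)%E; apply: (IH (fun i => B (lift ord0 i))) => i.
Qed.

End product_probability.

Section outer_and_inner.
Context (d : measure_display) (T : measurableType d) (R : realType).
Local Open Scope ereal_scope.

(* Upper integral of a nonnegative, possibly nonmeasurable, function.  (For a
   nonmeasurable function the library's integral is a lower integral.) *)
Definition upper_integral (mu : {measure set T -> \bar R}) (f : T -> \bar R)
    : \bar R :=
  ereal_inf [set \int[mu]_x g x | g in
    [set g : T -> \bar R | measurable_fun [set: T] g /\ forall x, f x <= g x]].

(* Lower bounds on the probability of a possibly nonmeasurable X are read as
   upper bounds on the outer probability of the exceptional set ~` X. *)
Definition inner_prob (P : probability T R) (X : set T) : \bar R :=
  1 - mu_ext P (~` X).

Lemma upper_integral_measurable (mu : {measure set T -> \bar R})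
    (f : T -> \bar R) : measurable_fun [set: T] f -> (forall x, 0 <= f x) ->
  upper_integral mu f = \int[mu]_x f x.
Proof.
move=> mf f0; apply/eqP; rewrite eq_le; apply/andP; split.
  by apply: ereal_inf_lbound; exists f.
apply: le_ereal_inf_tmp => _ [g [mg fg] <-].
by apply: ge0_le_integral => // x _; exact: le_trans (f0 x) (fg x).
Qed.

Lemma inner_prob_measurable (P : probability T R) (X : set T) :
  measurable X -> inner_prob P X = P X.
Proof.
move=> mX; rewrite /inner_prob measurable_mu_extE; last exact: measurableC.
rewrite -[in RHS](setCK X) (probability_setC P)//; exact: measurableC.
Qed.

End outer_and_inner.

Section convex_distance.
Context (R : realType).

(* The ambient space 'rV[R]_N carries the sup norm in the library, so the
   Euclidean norm is introduced separately. *)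
Definition l2norm (N : nat) (v : 'rV[R]_N) : R :=
  Num.sqrt (\sum_(i < N) v ord0 i ^+ 2).

(* Equal to +oo when V is empty. *)
Definition l2dist (N : nat) (u : 'rV[R]_N) (V : set 'rV[R]_N) : \bar R :=
  ereal_inf [set (l2norm (u - v))%:E | v in V].

Definition convex_hull (M : lmodType R) (U : set M) : set M :=
  smallest (@convex_set R M) U.

Context (T : Type) (N : nat).

Definition U_set (A : set (N.-tuple T)) (x : N.-tuple T) : set 'rV[R]_N :=
  [set s | (forall i, s ord0 i = 0 \/ s ord0 i = 1) /\
    exists y, A y /\ forall i, s ord0 i = 0 -> tnth x i = tnth y i].

Definition V_set (A : set (N.-tuple T)) (x : N.-tuple T) : set 'rV[R]_N :=
  convex_hull (U_set A x).

Definition f_c (A : set (N.-tuple T)) (x : N.-tuple T) : \bar R :=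
  l2dist 0 (V_set A x).

Definition A_c (A : set (N.-tuple T)) (t : R) : set (N.-tuple T) :=
  [set x | (f_c A x <= t%:E)%E].

End convex_distance.

(* Main.v *)
(* Induction on [N].  For [A] in [Omega ^ N.+1], with sections [A_w] and a
   projection [B], the convexity of the squared norm gives
   [f_c A (w, x) ^+ 2 <= (1 - l) ^+ 2 + l * f_c A_w x ^+ 2
                         + (1 - l) * f_c B x ^+ 2],
   and optimizing [l] in terms of [r = P A_w / P B] reduces the claim to
   [inf_l r ^ (- l) * expR ((1 - l) ^+ 2 / 4) <= 2 - r].
   Two changes deal with the lack of measurability of [f_c] and of the
   projection of [A].  First, [B] is the essential projection, the set of [x]
   whose fiber in [A] has positive [mu]-measure: it is measurable, it is
   contained in the projection, and by Fubini dropping the part of [A] that does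
   not lie over it costs nothing.  Second, the induction constructs a measurable
   function above [expR (f_c ^+ 2 / 4)], jointly measurable in [x] and in a
   parameter [z] on which [A] depends, so that the sections [A_w] can be treated
   at once with [w] as an additional parameter.  Young's inequality applied with
   the weights of the induction replaces Hoelder's inequality and keeps this
   function an explicit linear combination of the previous ones. *)

Require Import Defs.
From HB Require Import structures.
From mathcomp Require Import all_boot all_order all_algebra.
From mathcomp Require Import all_classical all_reals all_analysis.
From mathcomp Require Import measurable_realfun ring lra.
Import Order.TTheory GRing.Theory Num.Theory.
Import numFieldNormedType.Exports.
Local Open Scope classical_set_scope.
Local Open Scope ring_scope.

(** * Taylor bounds for the exponential and the one-variable optimization in [l] *)

Section real_inequalities.
Context {R : realType}.
Implicit Types (a b l r u x y : R).

Lemma ndecr0_le (f df : R -> R) u :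
  (forall x, is_derive x 1 f (df x)) -> (forall x, 0 < x -> 0 <= df x) ->
  0 <= u -> f 0 <= f u.
Proof.
move=> fdf df0 u0.
apply: (@ger0_derive1_ndecry _ f 0) => //.
- by move=> x; rewrite in_itv/= andbT derive1E => /df0; have /@derive_val -> := fdf x.
- by apply: derivable_within_continuous => x _; case: (fdf x).
Qed.

Lemma expRN_le2 u : 0 <= u -> expR (- u) <= 1 - u + u ^+ 2 / 2.
Proof.
move=> u0; rewrite -subr_ge0.
have := @ndecr0_le (fun u => 1 - u + u ^+ 2 / 2 - expR (- u))
  (fun u => - 1 + u + expR (- u)) u.
rewrite /= !(oppr0, expR0, expr0n, mul0r, addr0)/= ?mul0r ?addr0 subrr; apply => // [x|x _].
- by apply: is_derive_eq; rewrite /GRing.scale/=; field.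
- by have := expR_ge1Dx (- x); lra.
Qed.

Lemma expRN_ge3 u : 0 <= u -> 1 - u + u ^+ 2 / 2 - u ^+ 3 / 6 <= expR (- u).
Proof.
move=> u0; rewrite -subr_ge0.
have := @ndecr0_le (fun u => expR (- u) - (1 - u + u ^+ 2 / 2 - u ^+ 3 / 6))
  (fun u => 1 - u + u ^+ 2 / 2 - expR (- u)) u.
rewrite /= !(oppr0, expR0, expr0n, mul0r, addr0)/= ?mul0r ?oppr0 ?addr0 subrr; apply => // [x|x x0].
- by apply: is_derive_eq; rewrite /GRing.scale/=; field.
- by have := expRN_le2 x (ltW x0); lra.
Qed.

(** Multiply by the cubic lower bound of [expR (- u)]: the product of the two polynomials exceeds 1
    by [u ^+ 3] times a factor that is nonnegative on this range. *)
Lemma expR_le3 u : 0 <= u <= 4^-1 ->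
  expR u <= 1 + u + u ^+ 2 / 2 + u ^+ 3 / 2.
Proof.
move=> /andP[u0 u1].
have h := expRN_ge3 u u0.
have e : expR u * expR (- u) = 1 by rewrite -expRD subrr expR0.
have p : 0 < 1 - u + u ^+ 2 / 2 - u ^+ 3 / 6 by nra.
have hh : expR u * (1 - u + u ^+ 2 / 2 - u ^+ 3 / 6) <= 1.
  by rewrite -[leRHS]e ler_wpM2l// expR_ge0.
rewrite -(ler_pM2r p) (le_trans hh)//.
rewrite -subr_ge0 (_ : _ - _ =
  u ^+ 3 * (1 / 3 - 5 / 12 * u + u ^+ 2 / 6 - u ^+ 3 / 12)); last by field.
by rewrite mulr_ge0 ?exprn_ge0//; nra.
Qed.

(** This is the optimized inequality of the induction for [r = expR (- u)] and [l = 1 - 2 * u]. The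
    Taylor bounds reduce it to [w ^+ 2 + w ^+ 3 <= u ^+ 2] with [w = u - u ^+ 2]. *)
Lemma expR_subsqr_le u : 0 <= u <= 2^-1 -> expR (u - u ^+ 2) + expR (- u) <= 2.
Proof.
move=> /andP[u0 u1].
have h1 := expRN_le2 u u0.
have w : 0 <= u - u ^+ 2 <= 4^-1 by apply/andP; split; nra.
have h2 := expR_le3 _ w.
suff : u ^+ 2 * (1 - (1 - u) ^+ 2 - u * (1 - u) ^+ 3) >= 0.
  rewrite (_ : _ * _ = - ((u - u ^+ 2) ^+ 2 + (u - u ^+ 2) ^+ 3 - u ^+ 2)).
    by lra.
  by ring.
rewrite mulr_ge0 ?sqr_ge0// (_ : _ - _ = u * (2 - u - (1 - u) ^+ 3)); last by ring.
by rewrite mulr_ge0//; nra.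
Qed.

Lemma expR_convex l x y : 0 <= l <= 1 ->
  expR (l * x + (1 - l) * y) <= l * expR x + (1 - l) * expR y.
Proof.
move=> /andP[l0 l1]; set m := l * x + _.
(* Tangent line at the barycenter [m]; the linear terms cancel in the weighted average. *)
have tg z : expR m * (1 + (z - m)) <= expR z.
  by rewrite -[z in leRHS](subrKC m) (expRD m) ler_wpM2l ?expR_ge0// expR_ge1Dx.
rewrite (_ : expR m =
  l * (expR m * (1 + (x - m))) + (1 - l) * (expR m * (1 + (y - m)))).
  by apply: lerD; rewrite ler_wpM2l ?subr_ge0.
by move: (expR m) => e; rewrite /m; ring.
Qed.

(* The minimizer over [l] in [0, 1] of [(1 - l) ^+ 2 / 4 - l * ln r]. *)
Definition tal_weight r := if expR (- 2^-1) <= r then 1 + 2 * ln r else 0.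

Definition tal_factor r :=
  expR ((1 - tal_weight r) ^+ 2 / 4 - tal_weight r * ln r).

Lemma tal_weight_itv r : r <= 1 -> 0 <= tal_weight r <= 1.
Proof.
move=> r1; rewrite /tal_weight; case: ifPn => [er|_]; last by rewrite lexx/=.
have r0 : 0 < r by rewrite (lt_le_trans _ er)// expR_gt0.
have : - 2^-1 <= ln r by rewrite -ler_expR lnK ?posrE.
have : ln r <= 0 by exact: ln_le0.
by move=> ? ?; apply/andP; split; lra.
Qed.

Lemma tal_factor_le r : 0 <= r <= 1 -> tal_factor r <= 2 - r.
Proof.
move=> /andP[r0 r1]; rewrite /tal_factor /tal_weight; case: ifPn => [er|].
  have {}r0 : 0 < r by rewrite (lt_le_trans _ er)// expR_gt0.
  have h : - 2^-1 <= ln r by rewrite -ler_expR lnK ?posrE.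
  have h0 : ln r <= 0 by exact: ln_le0.
  have := @expR_subsqr_le (- ln r); rewrite opprK lnK ?posrE//.
  rewrite (_ : _ - (1 + _) * _ = - ln r - (- ln r) ^+ 2); last by field.
  by move=> H; rewrite lerBrDr; apply: H; apply/andP; split; lra.
rewrite -ltNge => rlt.
(* Below the threshold the weight is 0 and the factor is [expR 4^-1], its value at the threshold
   [u = 2^-1], while [r] is smaller than [expR (- 2^-1)]. *)
have := @expR_subsqr_le 2^-1.
rewrite (_ : 2^-1 - 2^-1 ^+ 2 = 4^-1 :> R); last by field.
rewrite subr0 mul0r subr0 expr1n mul1r => H.
have {}H := H ltac:(apply/andP; split; lra).
by rewrite lerBrDr (le_trans _ H)// lerD2l ltW.
Qed.

(** Once [tal_factor r] is split off, this is convexity of [expR] at the points [ln r + a / 4] and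
    [b / 4]. For [r = 0] the weight [l] is 0, so the value of [ln 0] does not matter. *)
Lemma tal_young r a b (l := tal_weight r) : 0 <= r <= 1 ->
  expR (((1 - l) ^+ 2 + l * a + (1 - l) * b) / 4) <=
  l * r * tal_factor r * expR (a / 4) + (1 - l) * tal_factor r * expR (b / 4).
Proof.
move=> /andP[r0 r1]; have l01 := tal_weight_itv r r1; rewrite -/l in l01.
rewrite (_ : (_ + _) / 4 = ((1 - l) ^+ 2 / 4 - l * ln r) +
  (l * (ln r + a / 4) + (1 - l) * (b / 4))); last by field.
rewrite expRD -/(tal_factor r).
rewrite [leRHS](_ : _ = tal_factor r *
  (l * (r * expR (a / 4)) + (1 - l) * expR (b / 4))); last by ring.
rewrite ler_wpM2l ?expR_ge0// (le_trans (expR_convex _ _ _ l01))//.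
rewrite lerD2r expRD /l /tal_weight; case: ifPn => [er|]; last by rewrite !mul0r.
by rewrite lnK ?posrE// (lt_le_trans _ er)// expR_gt0.
Qed.

Lemma measurable_tal_weight : measurable_fun [set: R] tal_weight.
Proof.
apply: measurable_fun_ifT => //; first exact: measurable_fun_ler.
apply: measurable_funD => //; apply: measurable_funM => //; exact: measurable_ln.
Qed.

Lemma measurable_tal_factor : measurable_fun [set: R] tal_factor.
Proof.
apply: measurableT_comp => //; apply: measurable_funB; last first.
  by apply: measurable_funM; [exact: measurable_tal_weight|exact: measurable_ln].
apply: measurable_funM => //; apply: measurable_funX; apply: measurable_funB => //.
exact: measurable_tal_weight.
Qed.

End real_inequalities.

(** * Convex hulls and prefixing a coordinate *)

Section convex_hulls.
Context {R : realType}.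

Definition sqnorm {n} (v : 'rV[R]_n) : R := \sum_(i < n) v ord0 i ^+ 2.

Lemma convex_hull_conv (M : lmodType R) (U : set M) (u v : M) (l : R) :
  0 <= l <= 1 -> convex_hull U u -> convex_hull U v ->
  convex_hull U (l *: u + (1 - l) *: v).
Proof.
move=> /andP[l0 l1] Uu Uv C [cC UC].
have := cC u v (Itv01 l0 l1).
by rewrite !inE; apply; [exact: Uu|exact: Uv].
Qed.

Lemma convex_hull_map (M M' : lmodType R) (f : M -> M')
    (U : set M) (W : set M') (v : M) :
  (forall l x y, f (l *: x + (1 - l) *: y) = l *: f x + (1 - l) *: f y) ->
  (forall u, U u -> W (f u)) -> convex_hull U v -> convex_hull W (f v).
Proof.
move=> faff fUW Uv C [cC WC]; apply: (Uv (f @^-1` C)); split.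
- move=> x y l; rewrite !inE => Cx Cy.
  have := cC (f x) (f y) l; rewrite !inE => /(_ Cx Cy).
  by congr (C _); exact/esym/faff.
- by move=> u Uu; apply: WC; exact: fUW.
Qed.

Definition row_cons {n} (c : R) (v : 'rV[R]_n) : 'rV[R]_n.+1 :=
  \row_i (if unlift ord0 i is Some j then v ord0 j else c).

Lemma row_cons0 n (c : R) (v : 'rV[R]_n) : row_cons c v ord0 ord0 = c.
Proof. by rewrite mxE unlift_none. Qed.

Lemma row_consS n (c : R) (v : 'rV[R]_n) (j : 'I_n) :
  row_cons c v ord0 (lift ord0 j) = v ord0 j.
Proof. by rewrite mxE liftK. Qed.

Lemma sqnorm_row_cons n (c : R) (v : 'rV[R]_n) :
  sqnorm (row_cons c v) = c ^+ 2 + sqnorm v.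
Proof.
rewrite /sqnorm big_ord_recl row_cons0; congr +%R.
by apply: eq_bigr => i _; rewrite row_consS.
Qed.

(** Prefixing [c] is affine, so it suffices to treat [U_set]. The case [c = 0] serves the sections
    of [A], where the first letter must be [w]; [c = 1] serves the projection, where any first
    letter will do. *)
Lemma V_set_cons (T : Type) n (c : R) (w : T) (x : n.-tuple T)
    (A : set (n.+1.-tuple T)) (A1 : set (n.-tuple T)) (v : 'rV[R]_n) :
  c = 0 \/ c = 1 ->
  (forall y, A1 y -> exists2 w', A [tuple of w' :: y] & c = 0 -> w = w') ->
  V_set A1 x v -> V_set A [tuple of w :: x] (row_cons c v).
Proof.
move=> c01 A1A; apply: convex_hull_map => [l u1 u2|s].
  apply/rowP => i; rewrite !mxE; case: (unlift ord0 i) => [j|]; rewrite ?mxE//.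
  by ring.
move=> [s01 [y [/A1A[w' Aw' cw'] sxy]]]; split.
  by move=> i; case: (unliftP ord0 i) => [j ->|->]; rewrite ?row_consS ?row_cons0.
exists [tuple of w' :: y]; split => // i.
case: (unliftP ord0 i) => [j ->|->]; last by rewrite row_cons0.
by rewrite row_consS !tnthS; exact: sxy.
Qed.

Lemma sqnorm_conv n (l : R) (u v : 'rV[R]_n) : 0 <= l <= 1 ->
  sqnorm (l *: u + (1 - l) *: v) <= l * sqnorm u + (1 - l) * sqnorm v.
Proof.
move=> /andP[l0 l1]; rewrite /sqnorm !mulr_sumr -big_split/=.
apply: ler_sum => i _; rewrite !mxE -subr_ge0.
rewrite (_ : _ - _ = l * (1 - l) * (u ord0 i - v ord0 i) ^+ 2); last by ring.
by rewrite mulr_ge0 ?sqr_ge0// mulr_ge0// subr_ge0.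
Qed.

End convex_hulls.

(** * Mixing a point over a section with a point over the projection *)

Section dominating_values.
Context {R : realType}.
Local Open Scope ereal_scope.

(* [h] bounds [expR (f_c A x ^+ 2 / 4)] from above, the infimum in [f_c] being
   bounded through a point of the hull. *)
Definition dominates {T : Type} {n : nat} (A : set (n.-tuple T))
    (x : n.-tuple T) (h : \bar R) :=
  h < +oo -> exists2 v : 'rV[R]_n, V_set A x v &
    (expR (sqnorm v / 4))%:E <= h.

Lemma dominates_cons (T : Type) (n : nat) (r : R) (w : T) (x : n.-tuple T)
    (A : set (n.+1.-tuple T)) (A1 B : set (n.-tuple T)) (h1 h2 : \bar R)
    (l := tal_weight r) :
  (0 <= r <= 1)%R ->
  (forall y, A1 y -> A [tuple of w :: y]) ->
  (forall y, B y -> exists w', A [tuple of w' :: y]) ->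
  0 <= h1 -> 0 <= h2 -> dominates A1 x h1 -> dominates B x h2 ->
  dominates A [tuple of w :: x]
    ((l * r * tal_factor r)%:E * h1 + ((1 - l) * tal_factor r)%:E * h2).
Proof.
move=> r01 A1A BA h10 h20 D1 D2.
have E0 : (0 < tal_factor r)%R by exact: expR_gt0.
have /andP[r0 r1] := r01.
have l01 : (0 <= l <= 1)%R by exact: tal_weight_itv.
have V1 v : V_set A1 x v -> V_set A [tuple of w :: x] (row_cons (0 : R)%R v).
  by apply: V_set_cons; [left|move=> y /A1A Ay; exists w].
have V2 v : V_set B x v -> V_set A [tuple of w :: x] (row_cons (1 : R)%R v).
  apply: V_set_cons; first by right.
  by move=> y /BA[w' Ay]; exists w' => // /eqP; rewrite oner_eq0.
(* At [l = 0] and [l = 1] one of [h1], [h2] has coefficient 0 and may be infinite, so only one of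
   the two hulls is known to contain a point. *)
have [l0|l0] := eqVneq l 0%R.
  rewrite l0 !mul0r mul0e add0e subr0 mul1r => h_fin.
  have {h_fin} h2oo : h2 < +oo.
    by move: h_fin; apply: contraTT; rewrite -!leNgt !leye_eq => /eqP ->;
      rewrite gt0_muley.
  have [v Vv vh] := D2 h2oo; exists (row_cons 1%R v); first exact: V2.
  have E0' : 0 <= (tal_factor r)%:E by rewrite lee_fin ltW.
  apply: le_trans (lee_wpmul2l E0' vh); rewrite lee_fin.
  have := tal_young r 0 (sqnorm v) r01; rewrite -/l l0 sqnorm_row_cons.
  by rewrite !mul0r subr0 !mul1r add0r addr0.
have r_gt0 : (0 < r)%R.
  move: l0; rewrite /l /tal_weight; case: ifPn => [h _|_]; last by rewrite eqxx.
  by rewrite (lt_le_trans _ h)// expR_gt0.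
have l_gt0 : (0 < l)%R by rewrite lt_neqAle eq_sym l0; case/andP: l01.
have c_gt0 : (0 < l * r * tal_factor r)%R by rewrite !mulr_gt0.
have h1oo (h' : \bar R) : 0 <= h' ->
    (l * r * tal_factor r)%:E * h1 + h' < +oo -> h1 < +oo.
  move=> h'0; apply: contraTT; rewrite -!leNgt !leye_eq => /eqP ->.
  by rewrite gt0_muley// addye// gt_eqF// (lt_le_trans _ h'0).
have [l1|l1] := eqVneq l 1%R.
  rewrite {2}l1 subrr mul0r mul0e => h_fin.
  have [v Vv vh] := D1 (h1oo _ (lexx _) h_fin).
  exists (row_cons 0%R v); first exact: V1.
  have c0 : 0 <= (l * r * tal_factor r)%:E by rewrite lee_fin ltW.
  rewrite adde0; apply: le_trans (lee_wpmul2l c0 vh); rewrite lee_fin.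
  have := tal_young r (sqnorm v) 0 r01; rewrite -/l l1 sqnorm_row_cons.
  by rewrite !subrr !mul0r !mul1r !addr0.
have l_lt1 : (0 < 1 - l)%R.
  by rewrite subr_gt0 lt_neqAle l1; case/andP: l01.
move=> h_fin.
have c2_gt0 : (0 < (1 - l) * tal_factor r)%R by rewrite mulr_gt0.
have {}h1oo : h1 < +oo.
  by apply: h1oo h_fin; rewrite mule_ge0// lee_fin ltW.
have h2oo : h2 < +oo.
  move: h_fin; apply: contraTT; rewrite -!leNgt !leye_eq => /eqP ->.
  rewrite gt0_muley// addey// gt_eqF// (lt_le_trans ltNy0)//.
  by rewrite mule_ge0// lee_fin ltW.
have [v1 Vv1 vh1] := D1 h1oo; have [v2 Vv2 vh2] := D2 h2oo.
(* The first coordinate of this mixture is [1 - l], the source of the term [(1 - l) ^+ 2]. *)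
exists (l *: row_cons 0 v1 + (1 - l) *: row_cons 1 v2)%R.
  by apply: convex_hull_conv => //; [exact: V1|exact: V2].
have -> : (l *: row_cons 0 v1 + (1 - l) *: row_cons 1 v2 =
    row_cons (1 - l) (l *: v1 + (1 - l) *: v2))%R.
  apply/rowP => i; rewrite !mxE; case: (unlift ord0 i) => [j|]; rewrite ?mxE//.
  by rewrite mulr0 add0r mulr1.
have c1_ge0 : 0 <= (l * r * tal_factor r)%:E by rewrite lee_fin ltW.
have c2_ge0 : 0 <= ((1 - l) * tal_factor r)%:E by rewrite lee_fin ltW.
apply: le_trans (leeD (lee_wpmul2l c1_ge0 vh1) (lee_wpmul2l c2_ge0 vh2)).
rewrite lee_fin.
rewrite (le_trans _ (tal_young r (sqnorm v1) (sqnorm v2) r01))//.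
rewrite ler_expR ler_wpM2r// sqnorm_row_cons -/l -addrA lerD2l.
exact: sqnorm_conv.
Qed.

End dominating_values.

(** * Regrouping coordinates and iterated integrals *)

Section induction_step.
Context {R : realType} {d : measure_display} {Omega : measurableType d}.
Variable mu : probability Omega R.
Local Open Scope ereal_scope.

(** Pulling [A] back along [cons_param] makes the first letter part of the parameter; along
    [cons_param_last] it makes the fiber over [(z, x)] an [xsection]. *)
Definition cons_param {Z : Type} {n} (u : (Z * Omega) * n.-tuple Omega) :
  Z * n.+1.-tuple Omega := (u.1.1, [tuple of u.1.2 :: u.2]).

Definition cons_param_last {Z : Type} {n} (u : (Z * n.-tuple Omega) * Omega) :
  Z * n.+1.-tuple Omega := (u.1.1, [tuple of u.2 :: u.1.2]).

Definition uncons_param {Z : Type} {n} (u : Z * n.+1.-tuple Omega) :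
  (Z * Omega) * n.-tuple Omega := ((u.1, thead u.2), [tuple of behead u.2]).

Lemma measurable_cons_param d' (Z : measurableType d') n :
  measurable_fun [set: (Z * Omega) * n.-tuple Omega] cons_param.
Proof.
apply: measurable_fun_pair.
  by apply: (measurableT_comp measurable_fst); exact: measurable_fst.
apply: measurable_cons; last exact: measurable_snd.
by apply: (measurableT_comp measurable_snd); exact: measurable_fst.
Qed.

Lemma measurable_cons_param_last d' (Z : measurableType d') n :
  measurable_fun [set: (Z * n.-tuple Omega) * Omega] cons_param_last.
Proof.
apply: measurable_fun_pair.
  by apply: (measurableT_comp measurable_fst); exact: measurable_fst.
apply: measurable_cons; first exact: measurable_snd.
by apply: (measurableT_comp measurable_snd); exact: measurable_fst.
Qed.

Lemma measurable_uncons_param d' (Z : measurableType d') n :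
  measurable_fun [set: Z * n.+1.-tuple Omega] uncons_param.
Proof.
apply: measurable_fun_pair; last first.
  by apply: (measurableT_comp (@measurable_behead _ _ n)); exact: measurable_snd.
apply: measurable_fun_pair; first exact: measurable_fst.
apply: (measurableT_comp (@measurable_tnth _ _ _ ord0)); exact: measurable_snd.
Qed.

Lemma integral_iter_prob_cons n (f : n.+1.-tuple Omega -> \bar R) :
  measurable_fun setT f -> (forall x, 0 <= f x) ->
  \int[iter_prob mu n.+1]_t f t =
  \int[mu]_w \int[iter_prob mu n]_x f [tuple of w :: x].
Proof.
move=> mf f0.
have mc := @measurable_cons_pair _ Omega n.
rewrite /= /distribution ge0_integral_pushforward//.
rewrite preimage_setT fubini_tonelli1//; first exact: measurableT_comp mf mc.
by move=> x; exact: f0.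
Qed.

Lemma product_measure_swap d1 d2 (T1 : measurableType d1)
    (T2 : measurableType d2) (m1 : {sigma_finite_measure set T1 -> \bar R})
    (m2 : {sigma_finite_measure set T2 -> \bar R}) (S : set (T1 * T2)) :
  measurable S -> (m1 \x m2) S = (m1 \x^ m2) S.
Proof.
by move=> mS; apply: product_measure_unique => //= *; rewrite product_measure2E.
Qed.



(** * The essential projection and the sections restricted to it *)

Section essential_projection.
Context {d' : measure_display} {Z : measurableType d'} {n : nat}.
Variable A : set (Z * n.+1.-tuple Omega).
Hypothesis mA : measurable A.

Definition ess_proj : set (Z * n.-tuple Omega) :=
  [set u | 0 < mu (xsection (cons_param_last @^-1` A) u)].

(** The restriction to [ess_proj] ensures that [P A_w] is at most [P B], so that the ratio [r] is at
    most 1. *)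
Definition ess_section : set ((Z * Omega) * n.-tuple Omega) :=
  cons_param @^-1` A `&` [set u | ess_proj (u.1.1, u.2)].

Lemma measurable_ess_proj : measurable ess_proj.
Proof.
have := measurable_cons_param_last _ Z n measurableT _ mA; rewrite setTI => mA'.
have := emeasurable_fun_o_infty measurableT (measurable_fun_xsection mu mA').
by move=> /(_ 0); rewrite setTI.
Qed.

Lemma measurable_ess_section : measurable ess_section.
Proof.
have := measurable_cons_param _ Z n measurableT _ mA; rewrite setTI => mA'.
apply: measurableI => //.
have mf : measurable_fun [set: (Z * Omega) * n.-tuple Omega]
    (fun u => (u.1.1, u.2)).
  apply: measurable_fun_pair; last exact: measurable_snd.
  by apply: (measurableT_comp measurable_fst); exact: measurable_fst.
by have := mf measurableT _ measurable_ess_proj; rewrite setTI.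
Qed.

Lemma ess_proj_ex z x : xsection ess_proj z x ->
  exists w, xsection A z [tuple of w :: x].
Proof.
move=> /xsectionP; apply: contraPP => /forallNP Ax; rewrite /ess_proj/=.
rewrite (_ : xsection _ _ = set0) ?measure0 ?ltxx//.
apply/seteqP; split=> // w /xsectionP Aw; apply: (Ax w); exact/xsectionP.
Qed.

Lemma ess_section_sub z w x : xsection ess_section (z, w) x ->
  xsection A z [tuple of w :: x].
Proof. by move=> /xsectionP[Awx _]; exact/xsectionP. Qed.

Lemma iter_prob_ess_section_le z w :
  iter_prob mu n (xsection ess_section (z, w)) <=
  iter_prob mu n (xsection ess_proj z).
Proof.
apply: le_measure; rewrite ?inE; [| |].
- by apply: measurable_xsection; exact: measurable_ess_section.
- by apply: measurable_xsection; exact: measurable_ess_proj.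
- by move=> x /xsectionP[_ Bx]; exact/xsectionP.
Qed.

(* Discarding the part of [A] outside the essential projection removes only
   null fibers. *)
Lemma integral_ess_section z :
  iter_prob mu n.+1 (xsection A z) =
  \int[mu]_w iter_prob mu n (xsection ess_section (z, w)).
Proof.
have mcons := @measurable_cons_pair _ Omega n.
set S := @cons_pair _ _ n @^-1` xsection A z.
have mS : measurable S.
  by rewrite -[S]setTI; apply: mcons => //; exact: measurable_xsection.
have mB := measurable_xsection z measurable_ess_proj.
set S' := S `&` (setT `*` xsection ess_proj z).
have mS' : measurable S' by apply: measurableI => //; exact: measurableX.
transitivity ((mu \x iter_prob mu n) S') => /=; last first.
  apply: eq_integral => w _ /=; congr (iter_prob mu n _).
  apply/seteqP; split=> x /xsectionP.
    by move=> [/xsectionP Awx [_ /xsectionP Bx]]; apply/xsectionP; split.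
  by move=> [Awx Bx]; apply/xsectionP; split; [|split => //]; exact/xsectionP.
transitivity ((mu \x iter_prob mu n) S) => //.
(* With the first letter integrated innermost, compare fibers over [x]: they coincide over the
   essential projection; elsewhere that of [S] is null and that of [S'] empty. *)
rewrite !product_measure_swap//; apply: eq_integral => x _ /=.
have SA : ysection S x = xsection (cons_param_last @^-1` A) (z, x).
  apply/seteqP; split=> w.
    by move=> /ysectionP/xsectionP Awx; exact/xsectionP.
  by move=> /xsectionP Awx; exact/ysectionP/xsectionP.
have [Bx|Bx] := pselect (ess_proj (z, x)).
  congr (mu _); apply/seteqP; split=> w /ysectionP.
    by move=> Sw; apply/ysectionP; split => //; split => //; exact/xsectionP.
  by move=> [Sw _]; exact/ysectionP.
rewrite (_ : ysection S' x = set0) ?measure0.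
  apply/eqP; rewrite SA eq_le measure_ge0 andbT leNgt.
  exact/negP.
apply/seteqP; split=> // w /ysectionP[_ [_ /xsectionP]]; exact: Bx.
Qed.

End essential_projection.
End induction_step.

(** * Construction of the measurable dominating function *)

Section dominating_function.
Context {R : realType} {d : measure_display} {Omega : measurableType d}.
Variable mu : probability Omega R.
Local Open Scope ereal_scope.

(** With [a] the integral of [p], integrating the pointwise bound gives [2 / q - a / q ^+ 2], which
    is at most [1 / a] because [(a - q) ^+ 2 >= 0]. *)
Lemma integral_le_inv_integral (p : Omega -> \bar R) (q : R) (h : Omega -> \bar R) :
  (0 < q)%R -> measurable_fun setT p -> measurable_fun setT h ->
  (forall w, 0 <= p w <= q%:E) -> (forall w, 0 <= h w) ->
  (forall w, h w <= ((2 - fine (p w) / q) / q)%:E) ->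
  \int[mu]_w h w <= (\int[mu]_w p w)^-1.
Proof.
move=> q0 mp mh p0 h0 hp.
have pfin w : p w \is a fin_num.
  have /andP[p0w pq] := p0 w.
  by rewrite ge0_fin_numE// (le_lt_trans pq)// ltry.
have ip0 : 0 <= \int[mu]_w p w.
  by apply: integral_ge0 => w _; have /andP[] := p0 w.
have ipq : \int[mu]_w p w <= q%:E.
  have -> : q%:E = \int[mu]_w (cst q%:E) w.
    rewrite integral_cst// [X in _ * X](_ : _ = 1) ?mule1//.
    exact: probability_setT.
  by apply: ge0_le_integral => // w _; have /andP[] := p0 w.
(* The term in [p] is moved to the left so that only nonnegative functions are integrated. *)
have : \int[mu]_w h w + (q ^- 2)%:E * \int[mu]_w p w <= (2 / q)%:E.
  rewrite -ge0_integralZl//; last 2 first.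
  - by move=> w _; have /andP[] := p0 w.
  - by rewrite lee_fin invr_ge0 exprn_ge0// ltW.
  have q2 w : 0 <= (q ^- 2)%:E * p w.
    rewrite mule_ge0//; last by have /andP[] := p0 w.
    by rewrite lee_fin invr_ge0 exprn_ge0// ltW.
  rewrite -ge0_integralD//; last exact: measurable_funeM.
  have -> : (2 / q)%:E = \int[mu]_w (cst (2 / q)%:E) w.
    rewrite integral_cst// [X in _ * X](_ : _ = 1) ?mule1//.
    exact: probability_setT.
  apply: ge0_le_integral => //.
  - by move=> w _; rewrite adde_ge0.
  - by apply: emeasurable_funD => //; exact: measurable_funeM.
  - move=> w _; rewrite (le_trans (leeD2r _ (hp w)))//.
    rewrite -(fineK (pfin w)) -EFinM -EFinD lee_fin le_eqVlt; apply/orP; left.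
    by apply/eqP; rewrite /=; field; rewrite gt_eqF.
move: ip0 ipq; case: (\int[mu]_w p w) => [a| |]//; rewrite !lee_fin => a0 aq.
have [->|a_neq0] := eqVneq a 0%R; first by rewrite inve0 leey.
have {a_neq0}a0 : (0 < a)%R by rewrite lt_neqAle eq_sym a_neq0.
rewrite -EFinM -leeBrDr// inver gt_eqF// => /le_trans; apply.
rewrite -EFinB lee_fin -subr_ge0.
rewrite (_ : (_ - _)%R = (a - q) ^+ 2 / (a * q ^+ 2))%R.
  by rewrite divr_ge0 ?sqr_ge0// mulr_ge0 ?exprn_ge0// ltW.
by field; rewrite !gt_eqF.
Qed.

(** For [p > 0] and [r = p / q], [r / p = 1 / q], so the left side collapses to
    [tal_factor r / q]. *)
Lemma tal_factor_inv (p q : R) : (0 < q)%R -> (0 <= p <= q)%R ->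
  (tal_weight (p / q) * (p / q) * tal_factor (p / q))%:E * (p%:E)^-1 +
  ((1 - tal_weight (p / q)) * tal_factor (p / q))%:E * (q%:E)^-1 <=
  ((2 - p / q) / q)%:E.
Proof.
move=> q0 /andP[p0 pq].
have r01 : (0 <= p / q <= 1)%R.
  by rewrite divr_ge0 ?(ltW q0)//= ler_pdivrMr// mul1r.
have -> : (tal_weight (p / q) * (p / q) * tal_factor (p / q))%:E * (p%:E)^-1 =
    (tal_weight (p / q) * tal_factor (p / q) / q)%:E.
  (* Here the inverse of [p] is [+oo], but its coefficient is 0 and the product is 0. *)
  have [->|p_neq0] := eqVneq p 0%R.
    rewrite mul0r mulr0 mul0r mul0e /tal_weight ifF ?mul0r//.
    by apply/negbTE; rewrite -ltNge expR_gt0.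
  rewrite inver (negbTE p_neq0) -EFinM; congr EFin.
  by field; rewrite p_neq0 gt_eqF.
rewrite inver gt_eqF// -EFinM -EFinD lee_fin -mulrDl -mulrDl subrKC mul1r.
by rewrite ler_wpM2r ?invr_ge0 ?(ltW q0)// tal_factor_le.
Qed.

(** The parameter space varies in the induction: the step uses [Z] for the essential projection and
    [Z * Omega] for the sections. *)
Lemma dominating_function n d' (Z : measurableType d')
    (A : set (Z * n.-tuple Omega)) : measurable A ->
  exists H : Z * n.-tuple Omega -> \bar R,
  [/\ measurable_fun setT H, forall u, 0 <= H u,
      forall z x, dominates (xsection A z) x (H (z, x)) &
      forall z, \int[iter_prob mu n]_x H (z, x) <=
                (iter_prob mu n (xsection A z))^-1].
Proof.
elim: n d' Z A => [|n IH] d' Z A mA.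
  (* In dimension 0 the only vector is 0, of norm 0, and it lies in the hull when the section is
     nonempty; hence the value [expR 0 = 1]. *)
  pose H (u : Z * 0.-tuple Omega) : \bar R := if u \in A then 1 else +oo.
  have mH : measurable_fun setT H.
    apply: measurable_fun_ifT => //; apply: (measurable_fun_bool true).
    rewrite setTI (_ : _ @^-1` _ = A)//.
    by apply/seteqP; split=> u; [exact: set_mem|exact: mem_set].
  exists H; split=> //.
  - by move=> u; rewrite /H; case: ifPn.
  - move=> z x; rewrite /H; case: ifPn => [|_]; last by rewrite /dominates ltxx.
    rewrite inE => Azx _; exists 0%R; last first.
      by rewrite /sqnorm big_ord0 mul0r expR0.
    move=> C [_]; apply; split; first by case.
    by exists x; split; [exact/xsectionP|case].
  - move=> z; rewrite integral_dirac//=; last first.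
      exact: measurableT_comp mH (pair1_measurable z).
    rewrite !diracE in_setT mul1e mem_xsection /H.
    by case: ifPn; rewrite ?inve1 ?inve0.
have [H2 [mH2 H2ge0 H2dom H2int]] := IH _ _ _ (measurable_ess_proj mu _ mA).
have [H1 [mH1 H1ge0 H1dom H1int]] := IH _ _ _ (measurable_ess_section mu _ mA).
pose q z := iter_prob mu n (xsection (ess_proj mu A) z).
pose p u := iter_prob mu n (xsection (ess_section mu A) u).
have mq : measurable_fun setT q.
  by apply: measurable_fun_xsection; exact: measurable_ess_proj.
have mp : measurable_fun setT p.
  by apply: measurable_fun_xsection; exact: measurable_ess_section.
(* When [q] vanishes this ratio is 0 by convention; the integral bound treats that case
   separately. *)
pose r (u : Z * Omega) := (fine (p u) / fine (q u.1))%R.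
have mr : measurable_fun setT r.
  rewrite (_ : r = fun u => fine (p u) * (fine (q u.1)) `^ (-1))%R; last first.
    by apply/funext => u; rewrite powR_inv1// fine_ge0// measure_ge0.
  apply: measurable_funM; first exact: measurableT_comp.
  apply: (@measurableT_comp _ _ _ _ _ _ (@powR R ^~ (- 1)%R)) => //.
  apply: measurableT_comp => //.
  by apply: (measurableT_comp mq); exact: measurable_fst.
pose a u := (tal_weight (r u) * r u * tal_factor (r u))%R.
pose b u := ((1 - tal_weight (r u)) * tal_factor (r u))%R.
have ma : measurable_fun setT a.
  apply: measurable_funM; last exact: (measurableT_comp measurable_tal_factor).
  by apply: measurable_funM => //; exact: (measurableT_comp measurable_tal_weight).
have mb : measurable_fun setT b.
  apply: measurable_funM; last exact: (measurableT_comp measurable_tal_factor).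
  by apply: measurable_funB => //; exact: (measurableT_comp measurable_tal_weight).
have pq z w : p (z, w) <= q z by exact: iter_prob_ess_section_le.
have pfin u : p u \is a fin_num.
  by apply: fin_num_measure; apply: measurable_xsection; exact: measurable_ess_section.
have qfin z : q z \is a fin_num.
  by apply: fin_num_measure; apply: measurable_xsection; exact: measurable_ess_proj.
have p0 u : (0 <= fine (p u))%R by rewrite fine_ge0// measure_ge0.
have q0 z : (0 <= fine (q z))%R by rewrite fine_ge0// measure_ge0.
have r01 u : (0 <= r u <= 1)%R.
  case: u => z w; rewrite /r/= divr_ge0//=.
  have [->|qz_neq0] := eqVneq (fine (q z)) 0%R; first by rewrite invr0 mulr0.
  have qz_gt0 : (0 < fine (q z))%R by rewrite lt0r qz_neq0 q0.
  by rewrite ler_pdivrMr// mul1r fine_le.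
have l01 u : (0 <= tal_weight (r u) <= 1)%R.
  by apply: tal_weight_itv; have /andP[] := r01 u.
have a0 u : 0 <= (a u)%:E.
  have /andP[l0 _] := l01 u; have /andP[r0 _] := r01 u.
  by rewrite lee_fin; apply: mulr_ge0; [exact: mulr_ge0|exact: expR_ge0].
have b0 u : 0 <= (b u)%:E.
  have /andP[_ l1] := l01 u.
  by rewrite lee_fin; apply: mulr_ge0; [rewrite subr_ge0|exact: expR_ge0].
pose K (v : (Z * Omega) * n.-tuple Omega) :=
  (a v.1)%:E * H1 v + (b v.1)%:E * H2 (v.1.1, v.2).
have mK : measurable_fun setT K.
  apply: emeasurable_funD; apply: emeasurable_funM => //.
  - apply/measurable_EFinP; apply: (measurableT_comp ma); exact: measurable_fst.
  - apply/measurable_EFinP; apply: (measurableT_comp mb); exact: measurable_fst.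
  - apply: (measurableT_comp mH2); apply: measurable_fun_pair.
      by apply: (measurableT_comp measurable_fst); exact: measurable_fst.
    exact: measurable_snd.
have K0 v : 0 <= K v by rewrite /K adde_ge0// mule_ge0.
have uncons (z : Z) (w : Omega) (x : n.-tuple Omega) :
    uncons_param (z, [tuple of w :: x]) = ((z, w), x).
  by rewrite /uncons_param/= theadE; congr pair; exact/val_inj.
exists (K \o uncons_param); split.
- exact: measurableT_comp mK (measurable_uncons_param _ _ _).
- by move=> u; exact: K0.
- move=> z t; rewrite [t]tuple_eta /comp uncons.
  apply: (@dominates_cons _ _ _ _ _ _ _ (xsection (ess_section mu A) (z, thead t))
    (xsection (ess_proj mu A) z)) => //.
  + by move=> y; exact: ess_section_sub.
  + by move=> y; exact: ess_proj_ex.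
- move=> z.
  have mKz : measurable_fun setT (fun t => (K \o uncons_param) (z, t)).
    apply: (measurableT_comp mK).
    exact: measurableT_comp (measurable_uncons_param _ _ _) (pair1_measurable z).
  rewrite integral_iter_prob_cons//; last by move=> x; exact: K0.
  (* A null essential projection makes the section of [A] null, and the right side is [+oo]. *)
  have [qz0|qz_neq0] := eqVneq (q z) 0.
    rewrite [X in _ <= X^-1](_ : _ = 0) ?inve0 ?leey//.
    rewrite (integral_ess_section _ _ mA) integral0_eq// => w _.
    by apply/eqP; rewrite eq_le measure_ge0 andbT -qz0; exact: pq.
  have qz_gt0 : (0 < fine (q z))%R.
    by rewrite lt0r q0 andbT fine_eq0.
  rewrite (integral_ess_section _ _ mA).
  under eq_integral do under eq_integral do rewrite /comp uncons.
  apply: (@integral_le_inv_integral _ (fine (q z))) => //.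
  + exact: measurableT_comp mp (pair1_measurable z).
  + exact: measurableT_comp (measurable_fun_fubini_tonelli_F _ mK K0)
      (pair1_measurable z).
  + by move=> w; rewrite measure_ge0/= fineK//; exact: pq.
  + by move=> w; exact: integral_ge0.
  (* For fixed [w], integrating [K] over [x] and applying both induction bounds gives the left side
     of [tal_factor_inv]. *)
  + move=> w.
    have := tal_factor_inv (fine (p (z, w))) (fine (q z)) qz_gt0.
    rewrite p0/= fine_le// => /(_ isT); apply: le_trans.
    have mH1zw : measurable_fun setT (fun x => H1 ((z, w), x)).
      exact: measurableT_comp mH1 (pair1_measurable (z, w)).
    have mH2z : measurable_fun setT (fun x => H2 (z, x)).
      exact: measurableT_comp mH2 (pair1_measurable z).
    rewrite /K/= ge0_integralD//.
    * rewrite ge0_integralZl// ge0_integralZl// !fineK// leeD//.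
        exact: lee_wpmul2l (H1int (z, w)).
      exact: lee_wpmul2l (H2int z).
    * by move=> x _; rewrite mule_ge0.
    * exact: measurable_funeM.
    * by move=> x _; rewrite mule_ge0.
    * exact: measurable_funeM.
Qed.

End dominating_function.

(** * From dominating values to the convex distance *)

Section convex_distance_bounds.
Context {R : realType} {T : Type} {n : nat}.
Local Open Scope ereal_scope.
Implicit Types (A : set (n.-tuple T)) (x : n.-tuple T).

Lemma f_c_ge0 A x : 0 <= f_c R A x.
Proof.
by apply: le_ereal_inf_tmp => _ [v _ <-]; rewrite lee_fin sqrtr_ge0.
Qed.

Lemma f_c_le A x (v : 'rV[R]_n) :
  V_set A x v -> f_c R A x <= (Num.sqrt (sqnorm v))%:E.
Proof.
move=> Vv; apply: ereal_inf_lbound; exists v => //.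
rewrite sub0r /l2norm /sqnorm; congr (Num.sqrt _)%:E.
by apply: eq_bigr => i _; rewrite mxE sqrrN.
Qed.

Lemma dominates_f_c A x (h : \bar R) :
  dominates A x h -> expeR ((4^-1)%:E * f_c R A x ^+ 2) <= h.
Proof.
move=> D; have [hoo|] := ltP h +oo; last by rewrite leye_eq => /eqP ->; rewrite leey.
have [v Vv] := D hoo; apply: le_trans.
have -> : (expR (sqnorm v / 4))%:E = expeR (sqnorm v / 4)%:E by [].
rewrite lee_expeR mulrC EFinM; apply: lee_wpmul2l; first by rewrite lee_fin invr_ge0.
have s0 : (0 <= sqnorm v)%R by apply: sumr_ge0 => i _; exact: sqr_ge0.
have -> : (sqnorm v)%:E = (Num.sqrt (sqnorm v))%:E ^+ 2.
  by rewrite -EFin_expe sqr_sqrtr.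
by apply: lee_pmul; rewrite ?f_c_ge0 ?f_c_le.
Qed.

End convex_distance_bounds.

(** * The exponential integral bound and the resulting tail bound *)

Local Open Scope ereal_scope.

Theorem theorem4p1p1 (R : realType) (d : measure_display)
    (Omega : measurableType d) (mu : probability Omega R)
    (N : nat) (hN : (1 <= N)%N)
    (A : set (N.-tuple Omega)) (mA : measurable A) :
  let P := iter_prob mu N in
  upper_integral P (fun x => expeR ((4^-1)%:E * f_c R A x ^+ 2)) <= (P A)^-1
  /\
  (forall t : R, (0 <= t)%R ->
    1 - (P A)^-1 * (expR (- (t ^+ 2 / 4)))%:E <= inner_prob P (A_c A t)).
Proof.
move=> P.
(* A one-point parameter space recovers the statement for a single set. *)
have mA' : measurable ([set: unit] `*` A) by exact: measurableX.
have [H [mH H0 Hdom Hint]] := dominating_function mu N _ _ _ mA'.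
pose h x := H (tt, x).
have mh : measurable_fun setT h by exact: measurableT_comp mH (pair1_measurable tt).
have h0 x : 0 <= h x by exact: H0.
have hint : \int[P]_x h x <= (P A)^-1.
  by have := Hint tt; rewrite in_xsectionX// in_setT.
have fch x : expeR ((4^-1)%:E * f_c R A x ^+ 2) <= h x.
  by apply: dominates_f_c; have := Hdom tt x; rewrite in_xsectionX// in_setT.
split.
  by apply: le_trans hint; apply: ereal_inf_lbound; exists h.
move=> t t0; rewrite /inner_prob leeB//.
(* Markov's inequality for [h] at level [e]: the measurable set [E] contains the exceptional set, so
   its probability bounds the outer one. *)
set e := expR (t ^+ 2 / 4).
have e0 : (0 < e)%R by exact: expR_gt0.
pose E := [set x | e%:E <= h x].
have mE : measurable E.
  by have := emeasurable_fun_c_infty measurableT mh => /(_ e%:E); rewrite setTI.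
have AE : ~` A_c A t `<=` E.
  move=> x /negP; rewrite -ltNge => tf; apply: le_trans (fch x).
  have -> : e%:E = expeR (t ^+ 2 / 4)%:E by [].
  rewrite lee_expeR mulrC EFinM; apply: lee_wpmul2l; first by rewrite lee_fin invr_ge0.
  by rewrite EFin_expe; apply: lee_pmul; rewrite ?lee_fin// ltW.
apply: (@le_trans _ _ (P E)).
  by rewrite -(measurable_mu_extE P mE); exact: le_mu_ext.
rewrite expRN -/e lee_pdivlMr// muleC.
apply: le_trans hint.
rewrite -integral_cst//; apply: (@le_trans _ _ (\int[P]_(x in E) h x)).
  by apply: ge0_le_integral => //; [move=> x _ /=; rewrite lee_fin ltW
    |exact: measurable_funTS].
by apply: ge0_subset_integral.
Qed.
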